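(* Let $R$ be a finite local ring with maximal ideal $M$ of order $m$. (a) If $|R|/m\equiv1\pmod 4$, then $E(\mathcal{G}_R)=\left(\sqrt{|R|/m}+1\right)|R^\times|/2$. (b) If $|R|/m\equiv 3\pmod 4$, then $E(\mathcal{G}_R)=2|R^\times|$.
   Context: A local ring is a commutative ring (with $1\neq0$) with a unique maximal ideal; $R^\times$ is its unit group. $Q_R=\{u^2:u\in R^\times\}$, $T_R=Q_R\cup(-Q_R)$, and the quadratic unitary Cayley graph $\mathcal{G}_R$ has vertex set $R$ with $x,y$ adjacent iff $x-y\in T_R$. The energy $E(G)$ of a graph is the sum of the absolute values of the eigenvalues of its adjacency matrix, counted with multiplicity. *)

(* Defs.v *)
From HB Require Import structures.
From mathcomp Require Import all_boot all_order all_algebra all_fingroup.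

Set Implicit Arguments.
Unset Strict Implicit.
Unset Printing Implicit Defensive.

Import Order.TTheory GRing.Theory Num.Theory.

Local Open Scope ring_scope.

(* idealr_closed is the library's notion of a proper ideal: it requires
   1 \notin I. *)
Definition maximal_ideal (R : finComUnitRingType) (I : {set R}) : Prop :=
  idealr_closed I /\
  forall J : {set R}, idealr_closed J -> I \subset J -> J = I.

Definition local_ring (R : finComUnitRingType) : Prop :=
  exists! M : {set R}, maximal_ideal M.

Definition unit_squares (R : finComUnitRingType) : {set R} :=
  [set u ^+ 2 | u : R in GRing.unit].

Definition signed_unit_squares (R : finComUnitRingType) : {set R} :=
  unit_squares R :|: [set - q | q in unit_squares R].

(* The adjacency relation of the graph; symmetric and irreflexive by
   quadratic_unitary_cayley_sym and quadratic_unitary_cayley_irr below. *)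
Definition quadratic_unitary_cayley (R : finComUnitRingType) : rel R :=
  fun x y => x - y \in signed_unit_squares R.

Definition adjacency_mx (C : numClosedFieldType) (T : finType) (e : rel T) :
    'M[C]_#|T| :=
  \matrix_(i, j) (e (enum_val i) (enum_val j))%:R.

(* The roots of the characteristic polynomial of A, listed with multiplicity. *)
Definition eigenvalues (C : numClosedFieldType) (n : nat) (A : 'M[C]_n) :
    seq C :=
  sval (closed_field_poly_normal (char_poly A)).

Definition energy (C : numClosedFieldType) (T : finType) (e : rel T) : C :=
  \sum_(a <- eigenvalues (adjacency_mx C e)) `|a|.

Lemma char_poly_eigenvalues (C : numClosedFieldType) (n : nat) (A : 'M[C]_n) :
  char_poly A = \prod_(a <- eigenvalues A) ('X - a%:P).
Proof.
rewrite /eigenvalues; case: closed_field_poly_normal => r /= {1}->.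
by rewrite (monicP (char_poly_monic A)) scale1r.
Qed.

Lemma quadratic_unitary_cayley_sym (R : finComUnitRingType) :
  symmetric (@quadratic_unitary_cayley R).
Proof.
suff sub (x y : R) : quadratic_unitary_cayley x y -> quadratic_unitary_cayley y x.
  by move=> x y; apply/idP/idP; apply: sub.
rewrite /quadratic_unitary_cayley -(opprB x y) !inE => /orP[Qxy|].
  by rewrite imset_f ?orbT.
by case/imsetP=> q Qq ->; rewrite opprK Qq.
Qed.

Lemma quadratic_unitary_cayley_irr (R : finComUnitRingType) :
  irreflexive (@quadratic_unitary_cayley R).
Proof.
move=> x; rewrite /quadratic_unitary_cayley subrr !inE.
have Q0 : 0 \notin unit_squares R.
  apply/imsetP=> -[u Uu] /esym u2_0.
  by have := unitrX 2 Uu; rewrite u2_0 unitr0.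
rewrite (negPf Q0) /=; apply/imsetP=> -[q Qq] /esym/eqP.
by rewrite oppr_eq0 => /eqP q0; rewrite -q0 Qq in Q0.
Qed.

(* Hence the quotient of natural numbers #|R| %/ #|M| is exact. *)
Lemma maximal_ideal_dvd (R : finComUnitRingType) (M : {set R}) :
  maximal_ideal M -> (#|M| %| #|R|)%N.
Proof.
case=> -[M0 _ Mlin] _.
have gM : group_set M.
  apply/group_setP; split=> // x y Mx My.
  by have := Mlin 1 x y Mx My; rewrite mul1r.
by have := cardSg (subsetT (Group gM)); rewrite cardsT.
Qed.

(* Main.v *)
(* Let q = |R|/m, odd. Squaring is 2-to-1 on the units, with kernel {1, -1},
   and 1 + M consists of squares, so membership in Q_R only depends on the
   residue class mod M, and -1 is a square iff q = 1 (mod 4). With J the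
   all-ones matrix and B the adjacency matrix of the cosets of M, the adjacency
   matrix A of the graph satisfies AB = mA, AJ = |T_R| J and
   A^2 = alpha J + beta B - mA, where alpha = beta = |Q_R|/2 if q = 1 (mod 4)
   (an autoconvolution of the quadratic character) and alpha = |R^x|, beta = 0
   if q = 3 (mod 4) (there T_R = R^x and A = J - B). Hence the spectrum lies in
   {|T_R|, 0, a, b} with b < 0 <= a the roots of t^2 + mt - beta m. On it |t| is
   a cubic polynomial in t, so the energy is a combination of the traces of
   A, A^2 and A^3. *)
Require Import Defs.
From HB Require Import structures.
From mathcomp Require Import all_boot all_order all_algebra all_fingroup all_solvable.
From mathcomp Require Import spectral ring.

Set Implicit Arguments.
Unset Strict Implicit.
Unset Printing Implicit Defensive.

Import Order.TTheory GRing.Theory Num.Theory.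

Local Open Scope ring_scope.

(** * Spectra of normal matrices *)

Lemma char_poly_conjugate (F : fieldType) (n : nat) (P A : 'M[F]_n) :
  P \in unitmx -> char_poly (invmx P *m A *m P) = char_poly A.
Proof.
move=> uP; rewrite /char_poly.
have -> : char_poly_mx (invmx P *m A *m P) =
    map_mx polyC (invmx P) *m char_poly_mx A *m map_mx polyC P.
  rewrite /char_poly_mx mulmxBr mulmxBl -!map_mxM; congr (_ - _).
  by rewrite mul_mx_scalar -scalemxAl -map_mxM mulVmx // map_mx1 scalemx1.
rewrite !det_mulmx mulrAC -det_mulmx -map_mxM mulVmx //.
by rewrite map_mx1 det1 mul1r.
Qed.

Section Spectrum.

Variables (C : numClosedFieldType) (n : nat) (A : 'M[C]_n).
Hypothesis nA : A \is normalmx.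

Let d j := spectral_diag A 0 j.

(** [eigenvalues] is an unspecified list of roots; factoring the characteristic polynomial through
    the diagonal form shows that it is a permutation of the [d j]. *)
Lemma sum_eigenvalues_normal (f : C -> C) :
  \sum_(a <- eigenvalues A) f a = \sum_j f (d j).
Proof.
have eig : perm_eq (eigenvalues A) [seq d j | j <- enum 'I_n].
  apply: prod_XsubC_eq; rewrite -char_poly_eigenvalues.
  rewrite {1}(orthomx_spectralP nA) char_poly_conjugate ?spectral_unit //.
  rewrite char_poly_trig ?diag_mx_is_trig // big_map big_enum /=.
  by apply: eq_bigr => j _; rewrite mxE eqxx mulr1n.
by rewrite (perm_big _ eig) big_map big_enum.
Qed.

Lemma mxtrace_normalX (i : nat) : \tr (A ^+ i) = \sum_j d j ^+ i.
Proof.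
have uP := spectral_unit A.
have -> : A ^+ i = invmx (spectralmx A) *m diag_mx (\row_j d j ^+ i) *m spectralmx A.
  elim: i => [|i IHi].
    rewrite expr0 (_ : \row_j _ = const_mx 1) ?diag_const_mx ?mulmx1 ?mulVmx //.
    by apply/rowP=> j; rewrite !mxE expr0.
  rewrite exprS -mulmxE IHi {1}(orthomx_spectralP nA) -!mulmxA.
  rewrite (mulKVmx uP) [X in _ *m X]mulmxA.
  rewrite mulmx_diag; congr (_ *m (diag_mx _ *m _)).
  by apply/rowP=> j; rewrite !mxE exprS.
rewrite mxtrace_mulC mulmxA mulmxV // mul1mx mxtrace_diag.
by apply: eq_bigr => j _; rewrite mxE.
Qed.

(** Row [j] of [spectralmx A] is a nonzero left eigenvector for [d j], so applying the vanishing
    matrix product to it leaves only the scalar product. *)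
Lemma spectral_diag_root (a b k : C) (j : 'I_n) :
  (A - k%:M) *m A *m (A - a%:M) *m (A - b%:M) = 0 ->
  (d j - k) * d j * (d j - a) * (d j - b) = 0.
Proof.
pose v := row j (spectralmx A).
have vA : v *m A = d j *: v.
  rewrite {1}(orthomx_spectralP nA) -row_mul !mulmxA mulmxV ?spectral_unit //.
  rewrite mul1mx row_mul row_diag_mx -scalemxAl -rowE //.
have vB c : v *m (A - c%:M) = (d j - c) *: v.
  by rewrite mulmxBr vA mul_mx_scalar scalerBl.
move=> /(congr1 (mulmx v)); rewrite mulmx0 !mulmxA vB -!scalemxAl vA.
rewrite -!scalemxAl vB -!scalemxAl vB !scalerA => /eqP.
rewrite scaler_eq0 => /orP[/eqP //|/eqP v0].
have := spectral_unit A; rewrite -row_free_unit => /row_freePn; case.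
by exists j; rewrite -/v v0 sub0mx.
Qed.

(* The cubic t - 2 t (t - a) (t - k) / ((b - a) (b - k)) agrees with `|t| on
   the spectrum {0, a, b, k}. *)
Lemma sum_norm_eigenvalues (a b k : C) :
  0 <= a -> b < 0 -> 0 <= k ->
  (A - k%:M) *m A *m (A - a%:M) *m (A - b%:M) = 0 ->
  \sum_(l <- eigenvalues A) `|l| =
    \tr A - 2 / ((b - a) * (b - k)) *
      (\tr (A ^+ 3) - (a + k) * \tr (A ^+ 2) + a * k * \tr A).
Proof.
move=> a0 b0 k0 A0; rewrite sum_eigenvalues_normal.
have ba : b - a != 0 by rewrite subr_eq0 lt_eqF // (lt_le_trans b0).
have bk : b - k != 0 by rewrite subr_eq0 lt_eqF // (lt_le_trans b0).
rewrite -[\tr A]/(\tr (A ^+ 1)) !mxtrace_normalX.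
rewrite !mulr_sumr -sumrB -big_split mulr_sumr -sumrB /=.
apply: eq_bigr => j _; move: (d j) (spectral_diag_root j A0) => t /eqP.
rewrite !mulf_eq0 !subr_eq0 -!orbA => /or4P[] /eqP->.
- by rewrite ger0_norm //; field; rewrite ba bk.
- by rewrite normr0; field; rewrite ba bk.
- by rewrite ger0_norm //; field; rewrite ba bk.
- by rewrite ltr0_norm //; field; rewrite ba bk.
Qed.

End Spectrum.

(** * Units and unit squares in a finite local ring *)

(** A nonunit generates a proper ideal; a maximal ideal above it must be [M] by uniqueness. *)
Lemma mem_maximal_ideal (R : finComUnitRingType) (M : {set R}) :
  local_ring R -> maximal_ideal M -> forall x, (x \in M) = (x \isn't a GRing.unit).
Proof.
move=> [N [_ uniqN]] maxM x; have [[M0 M1 Mlin] _] := maxM.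
apply/idP/idP=> [Mx|nUx].
  apply: contra M1 => Ux.
  by have := Mlin x^-1 x 0 Mx M0; rewrite addr0 mulVr.
(* A boolean form of [idealr_closed], so that [maxset_exists] yields the maximal ideal. *)
pose ideal (J : {set R}) := [&& 0 \in J, 1 \notin J &
  [forall a, [forall u in J, [forall v in J, a * u + v \in J]]]].
have idealP (J : {set R}) : reflect (idealr_closed J) (ideal J).
  apply: (iffP and3P) => -[J0 J1 Jlin]; split=> //.
    move=> a u v Ju Jv.
    by move/forallP/(_ a)/forall_inP/(_ u Ju)/forall_inP: Jlin; apply.
  by do 2![apply/forallP=> ?]; apply/implyP=> ?; apply/forall_inP=> *; apply: Jlin.
have /maxset_exists[J /maxsetP[/idealP idJ maxJ] sIJ] : ideal [set x * y | y : R].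
  apply/idealP; split.
  - by apply/imsetP; exists 0; rewrite ?mulr0.
  - apply: contra nUx => /imsetP[y _ xy]; apply/unitrP.
    by exists y; rewrite mulrC -xy.
  - move=> a _ _ /imsetP[y _ ->] /imsetP[z _ ->].
    by rewrite mulrCA -mulrDr imset_f.
rewrite -(uniqN _ maxM) (uniqN J); last by split=> // K /idealP idK; apply: maxJ.
by apply: (subsetP sIJ); apply/imsetP; exists 1; rewrite ?mulr1.
Qed.

Section OddLocalRing.

Variables (R : finComUnitRingType) (M : {set R}).
Hypotheses (localR : local_ring R) (maxM : maximal_ideal M).

Let memM := mem_maximal_ideal localR maxM.

Local Notation Q := (unit_squares R).

Lemma maximal_ideal0 : 0 \in M.
Proof. by case: maxM => -[]. Qed.

Lemma maximal_idealMl x y : y \in M -> x * y \in M.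
Proof.
case: maxM => -[M0 _ Mlin] _ My.
by have := Mlin x y 0 My M0; rewrite addr0.
Qed.

Lemma maximal_idealD : {in M &, forall x y, x + y \in M}.
Proof.
by case: maxM => -[_ _ Mlin] _ x y Mx My; have := Mlin 1 x y Mx My; rewrite mul1r.
Qed.

Lemma maximal_idealN x : (- x \in M) = (x \in M).
Proof. by rewrite !memM unitrN. Qed.

Lemma maximal_idealDr x y : y \in M -> (x + y \in M) = (x \in M).
Proof.
move=> My; apply/idP/idP=> [|Mx]; last exact: maximal_idealD.
rewrite -{2}[x](addrK y) => Mxy; apply: maximal_idealD => //.
by rewrite maximal_idealN.
Qed.

Lemma unitDr x y : y \in M -> (x + y \is a GRing.unit) = (x \is a GRing.unit).
Proof. by move/(maximal_idealDr x); rewrite !memM => /negb_inj. Qed.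

Lemma group_set_maximal_ideal : group_set M.
Proof.
by apply/group_setP; split=> [|x y]; [exact: maximal_ideal0 | exact: maximal_idealD].
Qed.

Lemma card_maximal_ideal : (#|R| = #|R| %/ #|M| * #|M|)%N.
Proof. by rewrite divnK // maximal_ideal_dvd. Qed.

Hypothesis odd_index : odd (#|R| %/ #|M|).

(** If 2 were in [M], the additive order of 1 in the quotient by [M] would divide both 2 and the odd
    index, which forces 1 into [M]. *)
Lemma unitr2 : (2 : R) \is a GRing.unit.
Proof.
apply/negPn; rewrite -memM; apply/negP=> M2.
pose G := Group group_set_maximal_ideal.
have nGR : [set: R] \subset 'N(G)%g.
  by apply/sub_abelian_norm; rewrite ?subsetT //; apply/centsP=> x _ y _; apply: addrC.
have /order_dvdG := mem_quotient G (in_setT (1 : R)).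
rewrite card_quotient // -divgS ?subsetT // cardsT => dvdRM.
have N1 := subsetP nGR 1 (in_setT _).
have dvd2 : (#[coset G (1%R : R)]%g %| 2)%N.
  by rewrite order_dvdn -morphX //; apply/eqP/coset_id.
have : (#[coset G (1%R : R)]%g %| gcdn 2 (#|R| %/ #|M|))%N by rewrite dvdn_gcd dvd2.
have /eqP -> : coprime 2 (#|R| %/ #|M|) by rewrite coprime2n.
rewrite dvdn1 order_eq1 => /eqP/coset_idr - /(_ N1).
by rewrite /= memM unitr1.
Qed.

Lemma odd_maximal_ideal : odd #|M|.
Proof.
apply/negPn/negP=> even_M.
(* An element of additive order 2 satisfies 2x = 0, which contradicts the invertibility of 2. *)
have [|x _ x2] := @Cauchy _ 2 (Group group_set_maximal_ideal) isT.
  by rewrite dvdn2.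
have := expg_order x; rewrite x2 FinRing.zmodXgE -mulr_natr => x20.
have x0 : x = 0 by apply: (mulIr unitr2); rewrite x20 mul0r.
by move: x2; rewrite x0 order1.
Qed.

(** In (u - v)(u + v) = 0 the factors differ by the unit 2v, so they are not both in [M]; the one
    that is a unit can be cancelled. *)
Lemma eq_sqr_unit (u v : R) : v \is a GRing.unit -> (u ^+ 2 == v ^+ 2) = (u == v) || (u == - v).
Proof.
move=> Uv; apply/idP/orP=> [|[]/eqP->]; rewrite ?sqrrN //.
rewrite -subr_eq0 subr_sqr => /eqP uv0.
have [Uuv|nUuv] := boolP (u - v \is a GRing.unit).
  right; rewrite -addr_eq0; apply/eqP.
  by apply: (mulrI Uuv); rewrite uv0 mulr0.
left; rewrite -subr_eq0; apply/eqP.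
suff Uuv : u + v \is a GRing.unit by apply: (mulIr Uuv); rewrite uv0 mul0r.
have -> : u + v = v * 2 + (u - v) by ring.
by rewrite unitDr ?memM // unitrM Uv unitr2.
Qed.

Lemma mem_unit_squares (u : R) : u \is a GRing.unit -> u ^+ 2 \in Q.
Proof. exact: imset_f. Qed.

Lemma unit_squares1 : 1 \in Q.
Proof. by rewrite -(expr1n _ 2) mem_unit_squares ?unitr1. Qed.

Lemma unit_squares_unit (x : R) : x \in Q -> x \is a GRing.unit.
Proof. by case/imsetP=> u Uu ->; apply: unitrX. Qed.

Lemma unit_squaresM (x y : R) : x \in Q -> y \in Q -> x * y \in Q.
Proof.
case/imsetP=> u Uu -> /imsetP[v Uv ->]; rewrite -exprMn.
by rewrite mem_unit_squares // unitrM Uu.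
Qed.

Lemma unit_squaresV (x : R) : x \in Q -> x^-1 \in Q.
Proof.
by case/imsetP=> u Uu ->; rewrite -exprVn mem_unit_squares // unitrV.
Qed.

Lemma unit_squaresMl (x y : R) : x \in Q -> (x * y \in Q) = (y \in Q).
Proof.
move=> Qx; apply/idP/idP=> [Qxy|]; last exact: unit_squaresM.
by rewrite -(mulKr (unit_squares_unit Qx) y) unit_squaresM ?unit_squaresV.
Qed.

Lemma one_neqN1 : 1 != -1 :> R.
Proof.
rewrite -addr_eq0; apply/eqP=> e.
by have := unitr2; rewrite (_ : 2 = 1 + 1) // e unitr0.
Qed.

Lemma card_units_squares : #|[set: {unit R}]| = (2 * #|Q|)%N.
Proof.
have -> : #|[set: {unit R}]| = #|[pred x : R | x \is a GRing.unit]|.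
  by rewrite cardsT card_sub.
rewrite -[LHS]sum1_card (partition_big (fun x => x ^+ 2) (mem Q)) /=; last first.
  by move=> u Uu; apply: mem_unit_squares.
(* The fibre of squaring over v^2 is {v, -v}, which has two elements because 1 and -1 differ. *)
rewrite mulnC -sum_nat_const; apply: eq_bigr => _ /imsetP[v Uv ->].
rewrite sum1_card (@eq_card _ _ (mem [set v; - v])).
  rewrite cards2; case: eqP => // vN; case/eqP: one_neqN1.
  by apply: (mulrI Uv); rewrite mulrN1 mulr1.
move=> u; rewrite unfold_in !inE eq_sqr_unit // andb_idl //.
by case/orP=> /eqP->; rewrite ?unitrN.
Qed.

Lemma card_units_maximal : (#|[set: {unit R}]| + #|M| = #|R|)%N.
Proof.
have -> : #|[set: {unit R}]| = #|~: M|.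
  by rewrite cardsT card_sub; apply: eq_card => x; rewrite !inE memM negbK.
by rewrite addnC cardsC.
Qed.

(** The map t |-> (1 + t)^2 - 1 sends [M] to itself and is injective there: the other possibility 1
    + x = -(1 + y) would put 2 in [M]. By finiteness it is onto [M]. *)
Lemma unit_squaresD1 t : t \in M -> 1 + t \in Q.
Proof.
pose f t := (1 + t) ^+ 2 - 1 : R.
have U1 x : x \in M -> 1 + x \is a GRing.unit by move/unitDr->; apply: unitr1.
have fM : f @: M = M.
  apply/eqP; rewrite eqEcard; apply/andP; split.
    apply/subsetP=> _ /imsetP[x Mx ->].
    have -> : f x = (2 + x) * x by rewrite /f; ring.
    exact: maximal_idealMl.
  rewrite card_in_imset // => x y Mx My /addIr/eqP.
  rewrite eq_sqr_unit ?U1 // => /orP[/eqP/addrI //|].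
  rewrite -addr_eq0 => /eqP e; have := maximal_idealD Mx My.
  rewrite memM -unitrN (_ : - (x + y) = 2) ?unitr2 //.
  by apply/eqP; rewrite eq_sym -subr_eq0 -e; apply/eqP; ring.
rewrite -{1}fM => /imsetP[x Mx ->]; rewrite addrC subrK mem_unit_squares //.
exact: U1.
Qed.

Lemma unit_squaresDr (x t : R) : t \in M -> (x + t \in Q) = (x \in Q).
Proof.
have sub y s : s \in M -> y \in Q -> y + s \in Q.
  move=> Ms Qy; rewrite -[s](mulKr (unit_squares_unit Qy)) mulrCA -{1}[y]mulr1 -mulrDr.
  rewrite unit_squaresM // mulrC; apply: unit_squaresD1.
  by rewrite mulrC maximal_idealMl.
move=> Mt; apply/idP/idP=> [Qxt|]; last exact: sub.
by rewrite -(addrK t x) sub // maximal_idealN.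
Qed.

(* A nonsquare unit x sends the squares, which make up half of the units, to
   all the nonsquare units. *)
Lemma nonsquareM (x y : R) : x \is a GRing.unit -> y \is a GRing.unit ->
  x \notin Q -> y \notin Q -> x * y \in Q.
Proof.
move=> Ux Uy nQx nQy.
pose N := [set z : R | (z \is a GRing.unit) && (z \notin Q)].
have cardN : (#|Q| + #|N| = #|[set: {unit R}]|)%N.
  have -> : #|[set: {unit R}]| = #|[set z : R | z \is a GRing.unit]|.
    by rewrite cardsT card_sub; apply: eq_card => z; rewrite !inE.
  rewrite -[RHS](cardsID Q); congr (_ + _)%N; apply: eq_card => z; rewrite 2!inE.
    by rewrite andb_idl //; apply: unit_squares_unit.
  by rewrite inE andbC.
have xQN : [set x * z | z in Q] = N.
  apply/eqP; rewrite eqEcard; apply/andP; split.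
    apply/subsetP=> _ /imsetP[z Qz ->].
    by rewrite inE unitrM Ux unit_squares_unit // mulrC unit_squaresMl.
  rewrite card_imset; last exact: mulrI.
  by rewrite -(leq_add2l #|Q|) cardN card_units_squares mul2n -addnn.
have : y \in N by rewrite inE Uy.
rewrite -xQN => /imsetP[z Qz ->]; rewrite mulrA unit_squaresM //.
exact: mem_unit_squares.
Qed.

Lemma card_units_index :
  #|[set: {unit R}]| = ((#|R| %/ #|M|).-1 * #|M|)%N.
Proof.
apply/eqP; rewrite -(eqn_add2r #|M|) card_units_maximal {1}card_maximal_ideal.
rewrite -mulSnr prednK //; case: (#|R| %/ #|M|)%N odd_index => //.
Qed.

Lemma unitN1 : (-1 : R) \is a GRing.unit.
Proof. by rewrite unitrN unitr1. Qed.

(** A square root of -1 has order 4 in the unit group, whose order is (q - 1) m with m odd; hence 4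
    divides q - 1. *)
Lemma sqrN1_index : -1 \in Q -> (#|R| %/ #|M| = 1 %[mod 4])%N.
Proof.
case/imsetP=> u Uu u2.
pose w : {unit R} := FinRing.unit R Uu.
have w4 : (w ^+ 4 = 1)%g.
  apply: val_inj; rewrite FinRing.val_unitX /= (exprM u 2 2) -u2 sqrrN expr1n //.
have w2 : (w ^+ 2 != 1)%g.
  apply/eqP=> /(congr1 val); rewrite FinRing.val_unitX /= -u2 => /esym/eqP.
  by rewrite (negPf one_neqN1).
have ow : #[w]%g = 4%N.
  have : (#[w]%g %| 2 ^ 2)%N by rewrite order_dvdn w4.
  case/dvdn_pfactor=> // -[|[|[|//]]] _ e //.
    by move: w2; rewrite -order_dvdn e.
  by move: w2; rewrite -order_dvdn e.
have : (4 %| #|[set: {unit R}]|)%N by rewrite -[4%N]ow order_dvdG // inE.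
rewrite card_units_index Gauss_dvdl; last by rewrite (@coprimeXl 2 2) // coprime2n odd_maximal_ideal.
case: (#|R| %/ #|M|)%N odd_index => // q _ /= dvd4q.
by rewrite -addn1 -modnDml (eqP dvd4q).
Qed.

(** The group of squares has order (q - 1) m / 2, which is even, so it contains an element of order
    2; by [eq_sqr_unit] this can only be -1. *)
Lemma index_sqrN1 : (#|R| %/ #|M| = 1 %[mod 4])%N -> -1 \in Q.
Proof.
move=> q1.
pose G := [set u : {unit R} | val u \in Q].
have gG : group_set G.
  apply/group_setP; split=> [|u v]; rewrite !inE /=; first exact: unit_squares1.
  exact: unit_squaresM.
have cardG : #|G| = #|Q|.
  rewrite -(card_imset _ val_inj); apply: eq_card => x.
  apply/imsetP/idP=> [[u + ->]|Qx]; first by rewrite inE.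
  by exists (FinRing.unit R (unit_squares_unit Qx)); rewrite ?inE.
have dvd2 : (2 %| #|Group gG|)%N.
  rewrite cardG -(@dvdn_pmul2l 2) // -card_units_squares card_units_index dvdn_mulr //.
  by move/eqP: q1; rewrite eqn_mod_dvd ?subn1 //; case: (_ %/ _)%N odd_index.
have [//|w Gw ow] := Cauchy _ dvd2.
have /(congr1 val)/eqP := expg_order w; rewrite ow FinRing.val_unitX /=.
rewrite -[X in _ == X](expr1n _ 2) eq_sqr_unit ?unitr1 // => /orP[/eqP w1|/eqP <-].
  have w1g : w = 1%g by apply: val_inj.
  by move: ow; rewrite w1g order1.
by move: Gw; rewrite inE.
Qed.

End OddLocalRing.

(** * Adjacency and convolution matrices *)

Lemma adjacency_mx_normal (C : numClosedFieldType) (T : finType) (e : rel T) :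
  symmetric e -> adjacency_mx C e \is normalmx.
Proof.
move=> sym_e; apply: symmetric_normalmx.
  by apply/is_hermitianmxP; rewrite scale1r; apply/matrixP=> i j; rewrite !mxE sym_e.
by apply/mxOverP=> i j; rewrite mxE realn.
Qed.

Section Convolution.

Variables (C : numClosedFieldType) (R : finZmodType).
Implicit Types f g : R -> C.

(** The regular representation of the group algebra of [R]. The adjacency matrix of a Cayley graph
    is the case where [f] is the indicator of the connection set. *)
Definition convolution_mx f : 'M[C]_#|R| :=
  \matrix_(i, j) f (enum_val i - enum_val j).

Lemma eq_convolution_mx f g : f =1 g -> convolution_mx f = convolution_mx g.
Proof. by move=> fg; apply/matrixP=> i j; rewrite !mxE fg. Qed.

Lemma mxtrace_convolution f : \tr (convolution_mx f) = #|R|%:R * f 0.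
Proof.
rewrite /mxtrace (eq_bigr (fun=> f 0)) => [|i _]; last by rewrite mxE subrr.
by rewrite sumr_const card_ord mulr_natl.
Qed.

Lemma mulmx_convolution f g :
  convolution_mx f *m convolution_mx g =
  convolution_mx (fun x => \sum_y f y * g (x - y)).
Proof.
apply/matrixP=> i j; rewrite !mxE.
(* The change of variable y = x_i - z turns the matrix product into a convolution. *)
pose h (k : 'I_#|R|) := enum_val i - enum_val k : R.
rewrite (reindex h) /=; last first.
  apply: onW_bij; exists (fun y => enum_rank (enum_val i - y)) => [k|y].
    by rewrite /h opprB addrC subrK enum_valK.
  by rewrite /h enum_rankK opprB addrC subrK.
apply: eq_bigr => k _; rewrite !mxE /h; congr (_ * g _).
by rewrite opprB [RHS]addrC addrA subrK.
Qed.

Lemma convolution_mxC f g :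
  convolution_mx f *m convolution_mx g = convolution_mx g *m convolution_mx f.
Proof.
rewrite !mulmx_convolution; apply: eq_convolution_mx => x.
rewrite (reindex_inj (inv_inj (subKr x))) /=.
by apply: eq_bigr => y _; rewrite subKr mulrC.
Qed.

Lemma convolution_mx_const f :
  convolution_mx f *m convolution_mx (fun=> 1) =
  (\sum_y f y) *: convolution_mx (fun=> 1).
Proof.
rewrite mulmx_convolution; apply/matrixP=> i j; rewrite !mxE mulr1.
by apply: eq_bigr => y _; rewrite mulr1.
Qed.

(** Convolving with the indicator of [M] sums [f] over translates by [M], on which it is
    constant. *)
Lemma convolution_mx_periodic (M : {set R}) f :
  (forall x t, t \in M -> f (x - t) = f x) ->
  convolution_mx f *m convolution_mx (fun x => (x \in M)%:R) =
  #|M|%:R *: convolution_mx f.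
Proof.
move=> fM; rewrite convolution_mxC mulmx_convolution.
apply/matrixP=> i j; rewrite !mxE mulr_natl -sumr_const [RHS]big_mkcond /=.
apply: eq_bigr => y _; case: ifP => My; rewrite ?mul0r // mul1r fM //.
Qed.

End Convolution.

(** * Energy from a quadratic matrix relation *)

Section Energy.

Variables (C : numClosedFieldType) (n : nat) (A B J : 'M[C]_n) (m alpha beta a b : C).
Hypotheses (nA : A \is normalmx) (trA : \tr A = 0).
Hypotheses (trB : \tr B = n%:R) (trJ : \tr J = n%:R).
Hypotheses (AJ : A *m J = (alpha + beta) *: J) (AB : A *m B = m *: A).
Hypotheses (AA : A *m A = alpha *: J + beta *: B - m *: A).
Hypotheses (ab_sum : a + b = - m) (ab_prod : a * b = - (beta * m)).
Hypotheses (a0 : 0 <= a) (b0 : b < 0) (k0 : 0 <= alpha + beta).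

(** The relations express A^3 through J, A and A^2. They supply both the annihilating polynomial
    with roots alpha + beta, 0, a, b and the traces that [sum_norm_eigenvalues] asks for. *)
Lemma sum_norm_eigenvalues_quadratic :
  \sum_(l <- eigenvalues A) `|l| =
    2 * n%:R * (alpha + beta) * (beta - b) / ((b - a) * (b - (alpha + beta))).
Proof.
have A3 : A ^+ 3 = (alpha * (alpha + beta)) *: J + (beta * m) *: A - m *: (A *m A).
  rewrite exprS expr2 -!mulmxE {1}AA mulmxBr mulmxDr -!scalemxAr AJ AB.
  by rewrite !scalerA.
(* Since a and b are the roots of t^2 + m t - beta m, the terms in A and A^2 cancel and only the
   multiple of J survives. *)
have A0 : A *m (A - a%:M) *m (A - b%:M) = (alpha * (alpha + beta)) *: J.
  rewrite [A *m (A - _)]mulmxBr mulmxBr !mul_mx_scalar mulmxBl -scalemxAl.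
  have -> : A *m A *m A = A ^+ 3 by rewrite exprSr expr2 -!mulmxE.
  rewrite A3; apply/matrixP=> i j; rewrite !mxE.
  have -> : beta * m = - (a * b) by rewrite ab_prod opprK.
  have -> : m = - (a + b) by rewrite ab_sum opprK.
  ring.
rewrite (@sum_norm_eigenvalues _ _ _ nA a b (alpha + beta)) //; last first.
  (* The remaining factor A - (alpha + beta) kills J. *)
  rewrite -!mulmxA [A *m _]mulmxA A0 -scalemxAr mulmxBl AJ mul_scalar_mx subrr.
  by rewrite scaler0.
have trA2 : \tr (A ^+ 2) = (alpha + beta) * n%:R.
  rewrite expr2 -mulmxE AA !raddfB !raddfD /= !mxtraceZ trA trB trJ; ring.
rewrite A3 !raddfB !raddfD /= !mxtraceZ trA trJ -[A *m A]/(A ^+ 2) trA2.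
have -> : beta * m = - (a * b) by rewrite ab_prod opprK.
have -> : m = - (a + b) by rewrite ab_sum opprK.
have ba : b - a != 0 by rewrite subr_eq0 lt_eqF // (lt_le_trans b0).
have bk : b - (alpha + beta) != 0 by rewrite subr_eq0 lt_eqF // (lt_le_trans b0).
by field; rewrite ba -opprD bk.
Qed.

End Energy.

(** * The quadratic character and its autoconvolution *)

Section QuadraticCharacter.

Variables (C : numClosedFieldType) (R : finComUnitRingType) (M : {set R}).
Hypotheses (localR : local_ring R) (maxM : maximal_ideal M).
Hypothesis odd_index : odd (#|R| %/ #|M|).

Let memM := mem_maximal_ideal localR maxM.

Local Notation Q := (unit_squares R).

(** For odd index this is the quadratic character of the residue field, pulled back to [R] and zero
    on [M]. *)
Definition quadratic_character (x : R) : C :=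
  if x \in Q then 1 else - (x \is a GRing.unit)%:R.

Local Notation chi := quadratic_character.

Lemma quadratic_characterE x :
  chi x = 2 * (x \in Q)%:R - (x \is a GRing.unit)%:R.
Proof.
rewrite /chi; case: ifP => [Qx|_]; last by rewrite mulr0 sub0r.
by rewrite (unit_squares_unit Qx) /= mulr1 (natrD _ 1 1) addrK.
Qed.

Lemma quadratic_character_nonunit x : x \isn't a GRing.unit -> chi x = 0.
Proof.
move=> nUx; rewrite /chi (negPf nUx) oppr0 ifN //.
by apply: contra nUx; apply: unit_squares_unit.
Qed.

Lemma quadratic_characterM x y : chi (x * y) = chi x * chi y.
Proof.
have [Ux|nUx] := boolP (x \is a GRing.unit); last first.
  rewrite (quadratic_character_nonunit nUx) mul0r quadratic_character_nonunit //.
  by rewrite unitrM negb_and nUx.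
have [Uy|nUy] := boolP (y \is a GRing.unit); last first.
  rewrite (quadratic_character_nonunit nUy) mulr0 quadratic_character_nonunit //.
  by rewrite unitrM negb_and nUy orbT.
rewrite /chi unitrM Ux Uy.
have [Qx|nQx] := boolP (x \in Q); first by rewrite unit_squaresMl // mul1r.
have [Qy|nQy] := boolP (y \in Q).
  by rewrite mulrC unit_squaresMl // (negPf nQx) mulr1.
by rewrite (nonsquareM localR maxM) // mulrNN mulr1.
Qed.

Lemma quadratic_character_sqr x : chi x * chi x = (x \is a GRing.unit)%:R.
Proof.
have [Ux|nUx] := boolP (x \is a GRing.unit); last first.
  by rewrite quadratic_character_nonunit ?mul0r.
by rewrite -quadratic_characterM /chi -expr2 mem_unit_squares.
Qed.

Lemma quadratic_characterDr x t : t \in M -> chi (x + t) = chi x.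
Proof.
by move=> Mt; rewrite /chi (unit_squaresDr localR maxM) // (unitDr localR maxM).
Qed.

Lemma sum_units : \sum_(x : R) (x \is a GRing.unit)%:R = #|[set: {unit R}]|%:R :> C.
Proof.
rewrite cardsT card_sub -sumr_const [RHS]big_mkcond /=.
by apply: eq_bigr => x _; rewrite mulrb.
Qed.

Lemma sum_unit_squares : \sum_(x : R) (x \in Q)%:R = #|Q|%:R :> C.
Proof.
rewrite -sumr_const [RHS]big_mkcond /=.
by apply: eq_bigr => x _; rewrite mulrb.
Qed.

Lemma sum_quadratic_character : \sum_x chi x = 0.
Proof.
under eq_bigr do rewrite quadratic_characterE.
rewrite sumrB -mulr_sumr sum_units sum_unit_squares.
by rewrite (card_units_squares localR maxM odd_index) natrM subrr.
Qed.

(** For x in [M] each term is chi(y)^2, and the sum counts the units. For a unit x it is a Jacobi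
    sum, evaluated by substituting x / y for y. *)
Lemma quadratic_character_autoconvolution x : -1 \in Q ->
  \sum_y chi y * chi (x - y) = #|R|%:R * (x \in M)%:R - #|M|%:R.
Proof.
move=> QN1; have chiN y : chi (- y) = chi y.
  by rewrite -mulN1r quadratic_characterM /chi QN1 mul1r.
have cardR : #|R|%:R = #|[set: {unit R}]|%:R + #|M|%:R :> C.
  by rewrite -natrD (card_units_maximal localR maxM).
have [Mx|nMx] := boolP (x \in M).
  rewrite mulr1 cardR addrK -sum_units; apply: eq_bigr => y _.
  by rewrite addrC quadratic_characterDr // chiN quadratic_character_sqr.
have Ux : x \is a GRing.unit by rewrite memM negbK in nMx.
rewrite mulr0 sub0r.
(* Factor y out of x - y and use chi(y)^2 = 1 on units. *)
transitivity (\sum_(y : R | y \is a GRing.unit) chi (x / y - 1)).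
  rewrite [RHS]big_mkcond; apply: eq_bigr => y _.
  case: ifPn => [Uy|nUy]; last by rewrite quadratic_character_nonunit ?mul0r.
  have {1}-> : x - y = y * (x / y - 1) by rewrite mulrBr mulr1 mulrC divrK.
  by rewrite quadratic_characterM mulrA quadratic_character_sqr Uy mul1r.
have divxK y : y \is a GRing.unit -> x / (x / y) = y.
  by move=> Uy; rewrite invrM ?unitrV // invrK mulrCA divrr ?mulr1.
(* The map y |-> x / y is an involution of the units. *)
rewrite (reindex_onto (fun y => x / y) (fun y => x / y)) //=.
transitivity (\sum_(y : R | y \is a GRing.unit) chi (y - 1)).
  apply: eq_big => y; rewrite unitrM Ux unitrV /=.
    by rewrite andb_idr // => /divxK->.
  by case/andP=> /divxK->.
(* Over all of [R] the sum of chi(y - 1) vanishes, so the units contribute minus the sum over [M],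
   where each term is chi(-1) = 1. *)
have := sum_quadratic_character; rewrite (reindex_inj (addIr (-1))) /=.
rewrite (bigID (fun y : R => y \is a GRing.unit)) /= => /eqP; rewrite addr_eq0 => /eqP->.
congr (- _); rewrite -sumr_const; apply: eq_big => [y|y nUy]; first by rewrite memM.
by rewrite addrC quadratic_characterDr ?memM // /chi QN1.
Qed.

End QuadraticCharacter.

(** * The energy of the quadratic unitary Cayley graph *)

Section QuadraticUnitaryCayleyEnergy.

Variables (C : numClosedFieldType) (R : finComUnitRingType) (M : {set R}).
Hypotheses (localR : local_ring R) (maxM : maximal_ideal M).

Local Notation Q := (unit_squares R).
Local Notation q := (#|R| %/ #|M|)%N.

Let J : 'M[C]_#|R| := convolution_mx (fun=> 1).
Let B : 'M[C]_#|R| := convolution_mx (fun x => (x \in M)%:R).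

Let trJ : \tr J = #|R|%:R.
Proof. by rewrite mxtrace_convolution mulr1. Qed.

Let trB : \tr B = #|R|%:R.
Proof. by rewrite mxtrace_convolution (maximal_ideal0 maxM) mulr1. Qed.

Let M_gt0 : 0 < #|M|%:R :> C.
Proof. by rewrite ltr0n; apply/card_gt0P; exists 0; apply: maximal_ideal0. Qed.

Let cardR : #|R|%:R = q%:R * #|M|%:R :> C.
Proof. by rewrite -natrM -card_maximal_ideal. Qed.

Let card_units : #|[set: {unit R}]|%:R = #|R|%:R - #|M|%:R :> C.
Proof. by rewrite -(card_units_maximal localR maxM) natrD addrK. Qed.

Lemma convolution_mx_ideal (f : R -> C) :
  (forall x t, t \in M -> f (x + t) = f x) ->
  convolution_mx f *m B = #|M|%:R *: convolution_mx f.
Proof.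
move=> fM; apply: convolution_mx_periodic => x t Mt.
by rewrite fM // (maximal_idealN localR maxM).
Qed.

Lemma energy_signed_squares_units :
  signed_unit_squares R =i GRing.unit ->
  energy C (@quadratic_unitary_cayley R) = 2 * #|[set: {unit R}]|%:R.
Proof.
move=> TU; set e := @quadratic_unitary_cayley R.
have nA := adjacency_mx_normal C (@quadratic_unitary_cayley_sym R : symmetric e).
have AE : adjacency_mx C e = convolution_mx (fun x => (x \is a GRing.unit)%:R).
  by apply/matrixP=> i j; rewrite !mxE /e /quadratic_unitary_cayley TU.
have AJB : adjacency_mx C e = J - B.
  rewrite AE; apply/matrixP=> i j; rewrite !mxE (mem_maximal_ideal localR maxM).
  by case: (_ \is a _) => /=; rewrite ?subr0 ?subrr.
have AJ : adjacency_mx C e *m J = (#|[set: {unit R}]|%:R + 0) *: J.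
  by rewrite AE convolution_mx_const sum_units addr0.
have AB : adjacency_mx C e *m B = #|M|%:R *: adjacency_mx C e.
  by rewrite AE convolution_mx_ideal // => x t /(unitDr localR maxM)->.
(* With beta = 0 the quadratic is t^2 + m t, so a = 0 and b = -m. *)
rewrite /energy (@sum_norm_eigenvalues_quadratic C _ _ B J #|M|%:R
  #|[set: {unit R}]|%:R 0 0 (- #|M|%:R)) //.
- rewrite !addr0 !subr0 !sub0r opprK -opprD mulrNN.
  have n_neq0 : #|R|%:R != 0 :> C by rewrite pnatr_eq0 -lt0n; apply/card_gt0P; exists 0.
  have m_neq0 : #|M|%:R != 0 :> C by rewrite gt_eqF.
  have -> : #|M|%:R + #|[set: {unit R}]|%:R = #|R|%:R :> C by rewrite card_units; ring.
  by field; rewrite m_neq0 n_neq0.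
- by rewrite AE mxtrace_convolution unitr0 mulr0.
- by rewrite {2}AJB mulmxBr AJ AB addr0 scale0r addr0.
- by rewrite add0r.
- by rewrite !mul0r oppr0.
- by rewrite oppr_lt0.
- by rewrite addr0 ler0n.
Qed.

Hypothesis odd_index : odd q.

Lemma energy_squares : -1 \in Q ->
  energy C (@quadratic_unitary_cayley R) =
    (sqrtC q%:R + 1) * #|[set: {unit R}]|%:R / 2.
Proof.
move=> QN1; set e := @quadratic_unitary_cayley R.
have nA := adjacency_mx_normal C (@quadratic_unitary_cayley_sym R : symmetric e).
have TQ : signed_unit_squares R =i Q.
  move=> x; rewrite inE orb_idr // => /imsetP[y Qy ->].
  by rewrite -mulN1r unit_squaresM.
have AE : adjacency_mx C e = convolution_mx (fun x => (x \in Q)%:R).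
  by apply/matrixP=> i j; rewrite !mxE /e /quadratic_unitary_cayley TQ.
pose k : C := #|Q|%:R.
have kE : #|[set: {unit R}]|%:R = 2 * k.
  by rewrite (card_units_squares localR maxM odd_index) natrM.
(* The square of A is obtained from that of the character matrix L = 2A - (J - B), which the
   autoconvolution gives. *)
pose L : 'M[C]_#|R| := convolution_mx (quadratic_character C (R := R)).
have LE : L = 2 *: adjacency_mx C e - (J - B).
  rewrite AE; apply/matrixP=> i j; rewrite !mxE (quadratic_characterE C).
  rewrite (mem_maximal_ideal localR maxM).
  by case: (_ \is a _) => /=; rewrite ?subrr ?subr0.
have AJ : adjacency_mx C e *m J = (k / 2 + k / 2) *: J.
  by rewrite AE convolution_mx_const sum_unit_squares -splitr.
have AB : adjacency_mx C e *m B = #|M|%:R *: adjacency_mx C e.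
  by rewrite AE convolution_mx_ideal // => x t /(unit_squaresDr localR maxM odd_index)->.
have AA : adjacency_mx C e *m adjacency_mx C e =
    (k / 2) *: J + (k / 2) *: B - #|M|%:R *: adjacency_mx C e.
  have LJ : L *m J = 0.
    by rewrite convolution_mx_const (sum_quadratic_character C localR maxM) // scale0r.
  have LB : L *m B = #|M|%:R *: L.
    by apply: convolution_mx_ideal => x t; apply: quadratic_characterDr.
  have LL : L *m L = #|R|%:R *: B - #|M|%:R *: J.
    rewrite mulmx_convolution; apply/matrixP=> i j; rewrite !mxE mulr1.
    exact: (quadratic_character_autoconvolution C localR maxM odd_index).
  have AJBL : adjacency_mx C e = 2^-1 *: (J - B + L).
    rewrite LE addrC subrK scalerA mulVf ?scale1r // pnatr_eq0 //.
  (* A and L commute as convolution matrices, so the product can be expanded as L (J - B + L) / 2,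
     where L J = 0 and L B = m L. *)
  have AL : adjacency_mx C e *m L = 2^-1 *: (L *m L - #|M|%:R *: L).
    rewrite AE convolution_mxC -AE {1}AJBL -scalemxAr mulmxDr mulmxBr LJ LB sub0r.
    by rewrite addrC.
  rewrite {2}AJBL -scalemxAr mulmxDr mulmxBr AJ AB AL LL LE.
  have -> : #|R|%:R = 2 * k + #|M|%:R by rewrite -kE card_units subrK.
  by apply/matrixP=> i j; rewrite !mxE; field.
(* As k = m (s^2 - 1) / 2, the quadratic t^2 + m t - k m / 2 has discriminant m^2 + 2 k m = (m s)^2
   and roots m (s - 1) / 2 and -m (s + 1) / 2. *)
pose s := sqrtC (q%:R : C).
have s2 : s ^+ 2 = q%:R by apply: sqrtCK.
(* This makes the root m (s - 1) / 2 nonnegative. *)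
have s_ge1 : 1 <= s.
  rewrite -(sqrtC1 C) ler_sqrtC ?nnegrE ?ler0n ?ler01 // ler1n.
  by case: q odd_index.
pose m : C := #|M|%:R.
have nE : #|R|%:R = s ^+ 2 * m by rewrite s2 -cardR.
have kms : k = m * (s ^+ 2 - 1) / 2.
  apply: (@mulfI _ 2); first by rewrite pnatr_eq0.
  by rewrite -kE card_units nE /m; field.
rewrite /energy (@sum_norm_eigenvalues_quadratic C _ _ B J m
  (k / 2) (k / 2) (m * (s - 1) / 2) (- (m * (s + 1) / 2))) //.
- have m_neq0 : m != 0 by rewrite gt_eqF.
  have s_neq0 : s != 0 by rewrite gt_eqF // (lt_le_trans ltr01).
  have s1_neq0 : s + 1 != 0 by rewrite gt_eqF // ltr_wpDr ?ler01 // (lt_le_trans ltr01).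
  have ba : - (m * (s + 1) / 2) - m * (s - 1) / 2 = - (m * s) by field.
  have bk : - (m * (s + 1) / 2) - (k / 2 + k / 2) = - (m * s * (s + 1) / 2).
    by rewrite kms; field.
  by rewrite kE ba bk nE -/s kms; field; rewrite m_neq0 s_neq0 s1_neq0.
- have Q0 : 0 \notin Q by apply: contraFN (unitr0 R); apply: unit_squares_unit.
  by rewrite AE mxtrace_convolution (negPf Q0) mulr0.
- by field.
- by rewrite kms; field.
- by rewrite divr_ge0 ?ler0n // mulr_ge0 ?ler0n // subr_ge0.
- by rewrite oppr_lt0 divr_gt0 ?ltr0n // mulr_gt0 // addr_gt0 ?ltr01 // (lt_le_trans ltr01).
- by rewrite -splitr ler0n.
Qed.

End QuadraticUnitaryCayleyEnergy.

Theorem theorem3p1 (C : numClosedFieldType) (R : finComUnitRingType)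
    (M : {set R}) (localR : local_ring R) (maxM : maximal_ideal M) :
  ((#|R| %/ #|M| = 1 %[mod 4])%N ->
     energy C (@quadratic_unitary_cayley R) =
       (sqrtC (#|R| %/ #|M|)%N%:R + 1) * #|[set: {unit R}]|%:R / 2) /\
  ((#|R| %/ #|M| = 3 %[mod 4])%N ->
     energy C (@quadratic_unitary_cayley R) = 2 * #|[set: {unit R}]|%:R).
Proof.
have odd_mod4 k : odd (k %% 4) -> odd k by rewrite (@odd_mod _ 4).
split=> q_mod4.
  have odd_q : odd (#|R| %/ #|M|) by apply: odd_mod4; rewrite q_mod4.
  by apply: energy_squares => //; apply: (index_sqrN1 localR maxM).
have odd_q : odd (#|R| %/ #|M|) by apply: odd_mod4; rewrite q_mod4.
apply: (energy_signed_squares_units _ localR maxM) => x.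
(* With -1 a nonsquare, every nonsquare unit x has -x = (-1) x a square, so the connection set
   consists of all the units. *)
have nQN1 : -1 \notin unit_squares R.
  by apply/negP=> /(sqrN1_index localR maxM odd_q); rewrite q_mod4.
rewrite inE; apply/orP/idP=> [[|/imsetP[y + ->]]|Ux].
- exact: unit_squares_unit.
- by rewrite unitrN; apply: unit_squares_unit.
have [Qx|nQx] := boolP (x \in unit_squares R); [by left | right].
apply/imsetP; exists (- x); last by rewrite opprK.
by rewrite -mulN1r (nonsquareM localR maxM) // unitN1.
Qed.
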